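(* Let $n$ be a positive even integer, let $m\ge 1$, and let $$P(z) = I z^{n} + A_{n-1} z^{n-1} + \dots + A_{1} z + A_{0}$$ be a monic matrix polynomial with $A_{j} \in \mathbb{C}^{m \times m}$ for $j=0,\dots,n-1$. Then the squares of the eigenvalues of $P$ are given by the eigenvalues of the monic matrix polynomial $$Q(z) = I z^{n/2} + B_{n/2-1} z^{n/2-1} + \dots + B_{1} z + B_{0},$$ where $B_{j} \in \mathbb{C}^{2m \times 2m}$ for $j=0,\dots,n/2-1$, with $$B_{0} = \begin{pmatrix} A_{0} & -A_{0}A_{n-1} \\ A_{1} & -A_{1}A_{n-1}+A_{0} \end{pmatrix}, \qquad B_{j} = \begin{pmatrix} A_{2j} & -A_{2j}A_{n-1}+A_{2j-1} \\ A_{2j+1} & -A_{2j+1}A_{n-1}+A_{2j} \end{pmatrix}, \quad j=1,2,\dots,n/2-1.$$ Moreover, let $\|\cdot\|$ be any matrix norm on $\mathbb{C}^{2m\times 2m}$ induced by a vector norm on $\mathbb{C}^{2m}$, let $B_{k}$ be invertible for some $k$ with $1 \leq k \leq n/2-1$, and let the real polynomial $$g_{k}(y)=y^{n/2} + \|B_{n/2-1}\|y^{n/2-1} + \dots + \|B_{k+1}\|y^{k+1} - \|B^{-1}_{k}\|^{-1}y^{k} + \|B_{k-1}\|y^{k-1} + \dots + \|B_{1}\|y + \|B_{0}\|$$ have two distinct positive roots $y_{1}$ and $y_{2}$ with $y_{1} < y_{2}$. Then $P$ has exactly $2km$ eigenvalues in the closed disk $|z|\le\sqrt{y_{1}}$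 and no eigenvalues in the open annulus $\sqrt{y_{1}} < |z| < \sqrt{y_{2}}$. In addition, all eigenvalues of $P$ lie in $|z| \leq \sqrt{\rho}$ and, when $B_{0}$ is nonsingular, in $|z| \geq \sqrt{\tau}$, where $\rho$ and $\tau$ are the unique positive roots of $$y^{n/2} - \|B_{n/2-1}\|y^{n/2-1} - \dots - \|B_{1}\|y - \|B_{0}\| = 0$$ and $$y^{n/2} + \|B_{n/2-1}\|y^{n/2-1} + \dots + \|B_{1}\|y - \|B^{-1}_{0}\|^{-1} = 0,$$ respectively.
   Context: The eigenvalues of a monic matrix polynomial $P(z)$ are the zeros of the scalar polynomial $\det(P(z))$, counted with multiplicity; thus a monic matrix polynomial of degree $n$ with $m\times m$ coefficients has $nm$ eigenvalues. $I$ denotes the identity matrix of the appropriate size ($m\times m$ in $P$, $2m\times 2m$ in $Q$). A matrix norm is induced by (subordinate to) a vector norm $\|\cdot\|$ if $\|A\| = \max_{\|v\|=1}\|Av\|$.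
   Formalization: The claim about ρ is stated when some B_j is nonzero; if all B_j vanish, then P(z) = I z^n and the equation defining ρ becomes y^{n/2} = 0, which has no positive root. *)

(* Defs.v *)
From mathcomp Require Import all_boot all_order all_algebra.
From mathcomp Require Import complex reals.

Set Implicit Arguments.
Unset Strict Implicit.
Unset Printing Implicit Defensive.

Import Order.TTheory GRing.Theory Num.Theory.
Local Open Scope ring_scope.

(* Complex numbers are R[i] for R : realType; the modulus is the real-valued
   Normc.normc, for which `|z| = (normc z)%:C. *)

(* A family of coefficients is indexed by nat; only A 0, ..., A n.-1 matter. *)
Definition monic_mxpoly (K : nzRingType) (m n : nat) (A : nat -> 'M[K]_m) :
    'M[{poly K}]_m :=
  ('X^n)%:M + \sum_(j < n) 'X^j *: map_mx polyC (A j).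

(* When \det P != 0 (in particular when P is monic), the zeros of \det P listed
   with multiplicity: the property of the witness is
   \det P = lead_coef (\det P) *: \prod_(z <- s) ('X - z%:P). *)
Definition mxpoly_eigenvalues (K : closedFieldType) (m : nat)
    (P : 'M[{poly K}]_m) : seq K :=
  sval (closed_field_poly_normal (\det P)).

Definition sq_coef (K : nzRingType) (m n : nat) (A : nat -> 'M[K]_m) (j : nat) :
    'M[K]_(m + m) :=
  if j is 0%N then
    block_mx (A 0%N) (- (A 0%N *m A n.-1))
             (A 1%N) (- (A 1%N *m A n.-1) + A 0%N)
  else
    block_mx (A j.*2) (- (A j.*2 *m A n.-1) + A j.*2.-1)
             (A j.*2.+1) (- (A j.*2.+1 *m A n.-1) + A j.*2).

Definition vector_norm (R : realType) (d : nat) (N : 'cV[R[i]]_d -> R) : Prop :=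
  [/\ forall v, 0 <= N v,
      forall v, N v = 0 -> v = 0,
      forall (a : R[i]) v, N (a *: v) = Normc.normc a * N v &
      forall v w, N (v + w) <= N v + N w].

(* nu A is the maximum of N (A v) over the unit sphere of N. *)
Definition induced_norm (R : realType) (d : nat) (N : 'cV[R[i]]_d -> R)
    (nu : 'M[R[i]]_d -> R) : Prop :=
  forall A : 'M[R[i]]_d,
    (exists2 v, N v = 1 & nu A = N (A *m v)) /\
    (forall v, N v = 1 -> N (A *m v) <= nu A).

Section ComparisonPolynomials.

Variables (R : realType) (d : nat) (nu : 'M[R[i]]_d -> R).
Variables (h : nat) (B : nat -> 'M[R[i]]_d).

Definition pellet_poly (k : nat) : {poly R} :=
  'X^h + \sum_(k.+1 <= j < h) nu (B j) *: 'X^j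
  - (nu (invmx (B k)))^-1 *: 'X^k + \sum_(0 <= j < k) nu (B j) *: 'X^j.

Definition cauchy_upper_poly : {poly R} :=
  'X^h - \sum_(0 <= j < h) nu (B j) *: 'X^j.

Definition cauchy_lower_poly : {poly R} :=
  'X^h + \sum_(1 <= j < h) nu (B j) *: 'X^j - ((nu (invmx (B 0%N)))^-1)%:P.

End ComparisonPolynomials.

Definition unique_positive_root (R : realType) (p : {poly R}) (y : R) : Prop :=
  unique (fun x => 0 < x /\ root p x) y.

(* Main.v *)
(** Splitting [P(z) = E(z^2) + z O(z^2)] into even and odd parts,
    [Q(y) = [E, y O; O, E] [I, -A_(n-1); 0, I]], and block elimination at
    [y = z^2] gives [det Q(z^2) = det P(z) det P(-z)], so the eigenvalues of [Q]
    are the squares of those of [P].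

    For the Pellet count, roots [a] of [det Q] with [|a| < r], counted with
    multiplicity, yield as many linearly independent solutions [u_i = O(r^i)] of
    the recurrence [sum_j B_j u_(i+j) = 0]. When the term [B_k] dominates on
    [|z| = r], solving for [u_(i+k)] is a contraction, so such a solution is
    determined by [u_0, ..., u_(k-1)]: at most [k d] roots lie inside, where [d]
    is the size of the matrices. The reversed polynomial has at most [(h - k) d]
    roots inside the inverse circle, and [det Q] has [h d] roots in all, so both
    bounds are attained. *)

Require Import Defs.
From mathcomp Require Import all_boot all_order all_algebra.
From mathcomp Require Import complex reals.
From mathcomp Require Import perm ring lra.

Set Implicit Arguments.
Unset Strict Implicit.
Unset Printing Implicit Defensive.

Import Order.TTheory GRing.Theory Num.Theory.
Local Open Scope ring_scope.

(** * The determinant identity for the squared eigenvalues *)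

Lemma sum_block_mx (R : nzRingType) (I : Type) (r : seq I) (m1 m2 n1 n2 : nat)
    (a : I -> 'M[R]_(m1, n1)) (b : I -> 'M[R]_(m1, n2))
    (c : I -> 'M[R]_(m2, n1)) (d : I -> 'M[R]_(m2, n2)) :
  \sum_(i <- r) block_mx (a i) (b i) (c i) (d i) =
  block_mx (\sum_(i <- r) a i) (\sum_(i <- r) b i)
           (\sum_(i <- r) c i) (\sum_(i <- r) d i).
Proof.
elim: r => [|x r IH]; first by rewrite !big_nil block_mx0.
by rewrite !big_cons IH add_block_mx.
Qed.

Lemma map_comp_monic_mxpoly (K : comNzRingType) (m n : nat) (A : nat -> 'M[K]_m)
    (q : {poly K}) :
  map_mx (comp_poly q) (monic_mxpoly n A) =
  (q ^+ n)%:M + \sum_(j < n) q ^+ j *: map_mx polyC (A j).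
Proof.
rewrite /monic_mxpoly map_mxD map_scalar_mx /= comp_Xn_poly map_mx_sum.
congr (_ + _); apply: eq_bigr => j _.
by rewrite map_mxZ /= comp_Xn_poly -map_mx_comp; congr (_ *: _);
  apply/matrixP => r s; rewrite !mxE /= comp_polyC.
Qed.

Section Squaring.

Variables (K : comNzRingType) (m h : nat) (A : nat -> 'M[K]_m).

Let C j : 'M[{poly K}]_m := map_mx polyC (A j).
Let n := h.+1.*2.
(** Here [P] is [ev + 'X *: od], with both parts written in ['X^2]; as [n] is even, the leading term
    belongs to [ev]. *)
Let ev : 'M[{poly K}]_m := ('X^n)%:M + \sum_(j < h.+1) ('X^2) ^+ j *: C j.*2.
Let od : 'M[{poly K}]_m := \sum_(j < h.+1) ('X^2) ^+ j *: C j.*2.+1.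

(** Stated for any [q] because it serves both ['X] and [- 'X], which share their square. *)
Lemma sum_even_odd (q : {poly K}) :
  \sum_(j < n) q ^+ j *: C j =
  \sum_(j < h.+1) (q ^+ 2) ^+ j *: C j.*2 +
  q *: \sum_(j < h.+1) (q ^+ 2) ^+ j *: C j.*2.+1.
Proof.
rewrite /n; elim: h.+1 => [|k IH]; first by rewrite !big_ord0 scaler0 addr0.
rewrite doubleS !big_ord_recr /= IH scalerDr scalerA -!exprM -exprS mul2n.
by rewrite addrACA -!addrA; congr (_ + _); rewrite addrCA.
Qed.

Lemma monic_mxpoly_even_odd : monic_mxpoly n A = ev + 'X *: od.
Proof. by rewrite /monic_mxpoly sum_even_odd addrA. Qed.

Lemma monic_mxpoly_comp_opp :
  map_mx (comp_poly (- 'X)) (monic_mxpoly n A) = ev - 'X *: od.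
Proof.
have sgn : (- 'X) ^+ n = 'X^n :> {poly K} by rewrite /n -mul2n !exprM sqrrN.
by rewrite map_comp_monic_mxpoly sum_even_odd sgn sqrrN scaleNr addrA.
Qed.

(** The right factor subtracts the first block column times [C n.-1] from the second. This removes
    the term of degree [n] from the upper right block, so [Q] is monic of degree [h.+1]. *)
Lemma sq_coef_comp_sqr :
  map_mx (comp_poly 'X^2) (monic_mxpoly h.+1 (sq_coef n A)) =
  block_mx ev ('X^2 *: od) od ev *m block_mx 1%:M (- C n.-1) 0 1%:M.
Proof.
rewrite map_comp_monic_mxpoly mulmx_block !mulmx1 !mulmx0 !addr0.
have -> : \sum_(j < h.+1) ('X^2) ^+ j *: map_mx polyC (sq_coef n A j) =
  \sum_(j < h.+1) block_mx (('X^2) ^+ j *: C j.*2)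
    (('X^2) ^+ j *: (- (C j.*2 *m C n.-1)) +
       (if j == 0%N :> nat then 0 else ('X^2) ^+ j *: C j.*2.-1))
    (('X^2) ^+ j *: C j.*2.+1)
    (('X^2) ^+ j *: (- (C j.*2.+1 *m C n.-1) + C j.*2)).
  apply: eq_bigr => -[[|j] lt_j] _ /=; rewrite map_block_mx scale_block_mx;
  by congr block_mx; rewrite /C ?raddfD ?raddfN /= ?map_mxM ?scalerDr ?addr0.
rewrite sum_block_mx.
rewrite -exprM mul2n -/n scalar_mx_block add_block_mx.
rewrite !add0r; congr block_mx.
- rewrite mulmxN /ev mulmxDl opprD big_split /= addrC [RHS]addrC addrA.
  congr (_ + _); last first.
    by rewrite mulmx_suml -sumrN; apply: eq_bigr => j _;
      rewrite scalerN -scalemxAl.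
  (* The top term of ['X^2 *: od] is ['X^n *: C n.-1] and cancels against the leading term of [ev];
     the others move up one index, which produces [C j.*2.-1]. *)
  rewrite big_ord_recl /= add0r /od [in RHS]big_ord_recr /=.
  rewrite scalerDr scaler_sumr scalerA -exprS -exprM mul2n -/n mul_scalar_mx addrK.
  by apply: eq_bigr => j _; rewrite scalerA -exprS.
- rewrite mulmxN /ev /od mulmx_suml -sumrN addrCA -big_split /=.
  by congr (_ + _); apply: eq_bigr => j _; rewrite scalerDr scalerN -scalemxAl.
Qed.

Lemma det_sq_coef :
  \det (monic_mxpoly h.+1 (sq_coef n A)) \Po 'X^2 =
  \det (monic_mxpoly n A) * (\det (monic_mxpoly n A) \Po (- 'X)).
Proof.
rewrite -2!det_map_mx sq_coef_comp_sqr monic_mxpoly_comp_opp.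
rewrite monic_mxpoly_even_odd det_mulmx det_ublock !det1 !mulr1.
(* Conjugation by the unipotent block matrix with corner ['X] leaves a block lower triangular matrix
   whose diagonal blocks are [P] at ['X] and at [- 'X]. *)
have -> : block_mx ev ('X^2 *: od) od ev =
    block_mx 1%:M (- 'X%:M) 0 1%:M *m
    (block_mx (ev + 'X *: od) 0 od (ev - 'X *: od) *m
     block_mx 1%:M 'X%:M 0 1%:M).
  move: ev od => E O.
  rewrite !mulmx_block !mulmx1 !mul1mx !mulmx0 !mul0mx !addr0 !add0r.
  rewrite !mulNmx !mul_scalar_mx !mul_mx_scalar ['X *: O + _]addrC subrK.
  by rewrite addrK scalerDr scalerA addrAC subrr add0r expr2.
by rewrite !det_mulmx !det_ublock det_lblock !det1 !mulr1 !mul1r.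
Qed.

End Squaring.

(** * Eigenvalues of monic matrix polynomials *)

Section TopCoefficient.

Variables (K : comNzRingType) (n : nat).

(** Coefficients in the degree bound [n] multiply even where they vanish, so no factor needs exact
    degree [n]. *)
Lemma prod_top_coef (I : Type) (r : seq I) (p : I -> {poly K}) :
  (forall i, (size (p i) <= n.+1)%N) ->
  (size (\prod_(i <- r) p i)%R <= (size r * n).+1)%N /\
  (\prod_(i <- r) p i)`_(size r * n) = \prod_(i <- r) (p i)`_n.
Proof.
move=> sz_p; elim: r => [|i r [IHs IHc]].
  by rewrite !big_nil size_poly1 coef1.
rewrite !big_cons /= mulSn; set q := \prod_(j <- r) p j in IHs IHc *.
split.
  apply: (leq_trans (size_polyMleq _ _)); rewrite -ltnS.
  have := leq_add (sz_p i) IHs; rewrite addSn addnS.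
  by case: (_ + size q)%N.
have nlt : (n < (n + size r * n).+1)%N by rewrite ltnS leq_addr.
rewrite coefM (bigD1 (Ordinal nlt)) //= addKn IHc [X in _ + X]big1 ?addr0 // => j.
rewrite -val_eqE /= => ne_jn; case: (ltnP n j) => [lt_nj | le_jn].
  by rewrite nth_default ?mul0r // (leq_trans (sz_p i)).
rewrite [q`__]nth_default ?mulr0 // (leq_trans IHs) //.
by rewrite -addnBAC // -addn1 addnC leq_add2r subn_gt0 ltn_neqAle ne_jn.
Qed.

Lemma det_top_coef (m : nat) (M : 'M[{poly K}]_m) :
  (forall i j, (size (M i j) <= n.+1)%N) ->
  (size (\det M) <= (m * n).+1)%N /\
  (\det M)`_(m * n) = \det (map_mx (fun p : {poly K} => p`_n) M).
Proof.
move=> szM; have top (s : 'S_m) :=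
  prod_top_coef (index_enum 'I_m) (p := fun i => M i (s i)) (fun i => szM i (s i)).
have sz_enum : size (index_enum 'I_m) = m.
  by rewrite -sum1_size big_const_ord iter_addn_0 mul1n.
split.
  apply: (leq_trans (size_sum _ _ _)); apply/bigmax_leqP => s _.
  rewrite mulr_sign; have [+ _] := top s; rewrite sz_enum.
  by case: ifP; rewrite ?size_polyN.
rewrite /determinant coef_sum; apply: eq_bigr => s _.
have [_ +] := top s; rewrite sz_enum => eq_top.
rewrite -signr_odd -[in LHS](rmorph_sign polyC) coefCM eq_top.
by rewrite signr_odd; congr (_ * _); apply: eq_bigr => i _; rewrite mxE.
Qed.

(** The coefficients of degree [n] form the identity matrix, so the top coefficient of the
    determinant is 1. *)
Lemma det_monic_mxpoly_top (m : nat) (A : nat -> 'M[K]_m) :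
  (0 < n)%N ->
  size (\det (monic_mxpoly n A)) = (m * n).+1 /\
  \det (monic_mxpoly n A) \is monic.
Proof.
move=> n_gt0.
have coefP i j l : (monic_mxpoly n A i j)`_l =
    (i == j)%:R *+ (l == n) + if (l < n)%N then A l i j else 0.
  rewrite !mxE coefD summxE coef_sum; congr (_ + _).
    by rewrite coefMn coefXn; case: (i == j); case: (l == n).
  case: ifP => [lt_ln|ge_ln].
    rewrite (bigD1 (Ordinal lt_ln)) //= big1 => [|k ne].
      by rewrite !mxE coefMC coefXn eqxx mul1r addr0.
    rewrite !mxE coefMC coefXn; case: eqP => [e|]; rewrite ?mul0r //.
    by case/eqP: ne; apply: val_inj.
  rewrite big1 // => k _; rewrite !mxE coefMC coefXn.
  by case: eqP => [e|]; rewrite ?mul0r //; rewrite e ltn_ord in ge_ln.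
have szP i j : (size (monic_mxpoly n A i j) <= n.+1)%N.
  apply/leq_sizeP => l lt_nl; rewrite coefP ltn_geF 1?ltnS ?(ltnW lt_nl) //.
  by rewrite gtn_eqF // addr0.
have [sz_det] := det_top_coef szP.
have -> : map_mx (fun p : {poly K} => p`_n) (monic_mxpoly n A) = 1%:M.
  by apply/matrixP => i j; rewrite mxE coefP [RHS]mxE eqxx ltnn addr0.
rewrite det1 => top1.
have sz : size (\det (monic_mxpoly n A)) = (m * n).+1.
  apply/eqP; rewrite eqn_leq sz_det ltnNge; apply/negP => le_sz.
  by move: top1; rewrite nth_default // => /eqP; rewrite eq_sym oner_eq0.
by split=> //; rewrite monicE lead_coefE sz top1.
Qed.

End TopCoefficient.

Section Eigenvalues.

Variables (K : closedFieldType) (m n : nat) (A : nat -> 'M[K]_m).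
Hypothesis n_gt0 : (0 < n)%N.

Lemma det_monic_mxpoly_eigenvalues :
  \det (monic_mxpoly n A) =
  \prod_(z <- mxpoly_eigenvalues (monic_mxpoly n A)) ('X - z%:P).
Proof.
rewrite /mxpoly_eigenvalues; case: closed_field_poly_normal => s /= {1}->.
have [_ /monicP ->] := det_monic_mxpoly_top A n_gt0.
by rewrite scale1r.
Qed.

Lemma size_mxpoly_eigenvalues :
  size (mxpoly_eigenvalues (monic_mxpoly n A)) = (m * n)%N.
Proof.
have [] := det_monic_mxpoly_top A n_gt0.
by rewrite det_monic_mxpoly_eigenvalues size_prod_XsubC => -[].
Qed.

End Eigenvalues.

Lemma perm_sqr_eigenvalues (K : closedFieldType) (n m : nat) (A : nat -> 'M[K]_m) :
  (0 < n)%N -> ~~ odd n ->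
  perm_eq [seq z ^+ 2 | z <- mxpoly_eigenvalues (monic_mxpoly n A)]
          (mxpoly_eigenvalues (monic_mxpoly n./2 (sq_coef n A))).
Proof.
move=> n_gt0 n_even; have := even_halfK n_even; case: n./2 => [n0|h nE].
  by rewrite -n0 in n_gt0.
apply: prod_XsubC_eq; rewrite -det_monic_mxpoly_eigenvalues //.
apply/eqP; rewrite -subr_eq0.
(* Substituting ['X^2] is injective, and after it the determinant identity applies. *)
rewrite -(@comp_poly_eq0 _ _ 'X^2) ?size_polyXn // comp_polyB subr_eq0.
have := det_sq_coef h A; rewrite nE => ->.
have := size_mxpoly_eigenvalues A n_gt0.
rewrite det_monic_mxpoly_eigenvalues //; set s := mxpoly_eigenvalues _ => sz_s.
rewrite !rmorph_prod /= big_map -big_split /=.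
(* Each factor [('X - z)(- 'X - z)] is [- ('X^2 - z^2)]; there are [m * n] of them, an even number,
   so the signs cancel. *)
have sgn : \prod_(z <- s) (-1 : {poly K}) = 1.
  rewrite big_const_seq count_predT sz_s -Monoid.iteropE /=.
  rewrite -[iterop _ _ _ _]/((-1) ^+ (m * n)) -signr_odd oddM.
  by rewrite (negbTE n_even) andbF.
apply/eqP; rewrite -[RHS]mulr1 -[X in _ * X]sgn. rewrite -[RHS]big_split /=.
apply: eq_bigr => z _; rewrite !comp_polyB !comp_polyX !comp_polyC rmorphXn /=.
by rewrite mulrN1; ring.
Qed.

(** * Geometrically bounded solutions of matrix recurrences *)

Section ShiftAction.

Variables (K : comNzRingType) (V : lmodType K).

(* The action of [p] on sequences in which ['X] acts as the left shift. *)
Definition shift_act (p : {poly K}) (x : nat -> V) (i : nat) : V :=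
  \sum_(j < size p) p`_j *: x (i + j)%N.

Lemma shift_act_widen (n : nat) (p : {poly K}) x i :
  (size p <= n)%N -> shift_act p x i = \sum_(j < n) p`_j *: x (i + j)%N.
Proof.
move=> le_pn; rewrite /shift_act (big_ord_widen n (fun j => p`_j *: x (i + j)%N)) //.
rewrite big_mkcond; apply: eq_bigr => j _.
by case: ltnP => // le_pj; rewrite nth_default ?scale0r.
Qed.

Lemma shift_actDl p q x i :
  shift_act (p + q) x i = shift_act p x i + shift_act q x i.
Proof.
pose n := maxn (size p) (size q).
rewrite !(@shift_act_widen n) ?size_polyD ?leq_maxl ?leq_maxr //.
by rewrite -big_split; apply: eq_bigr => j _; rewrite coefD scalerDl.
Qed.

Lemma shift_act0l x i : shift_act 0 x i = 0.
Proof. by rewrite /shift_act size_poly0 big_ord0. Qed.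

Lemma shift_act_suml (I : Type) (r : seq I) (p : I -> {poly K}) x i :
  shift_act (\sum_(s <- r) p s) x i = \sum_(s <- r) shift_act (p s) x i.
Proof.
elim: r => [|s r IH]; first by rewrite !big_nil shift_act0l.
by rewrite !big_cons shift_actDl IH.
Qed.

Lemma shift_actZl c p x i : shift_act (c *: p) x i = c *: shift_act p x i.
Proof.
rewrite (@shift_act_widen (size p)) ?size_scale_leq // scaler_sumr.
by apply: eq_bigr => j _; rewrite coefZ scalerA.
Qed.

Lemma shift_actMX p x i : shift_act (p * 'X) x i = shift_act p (x \o succn) i.
Proof.
rewrite (@shift_act_widen (size p).+1); last first.
  by rewrite (leq_trans (size_polyMleq _ _)) // size_polyX addn2.
rewrite big_ord_recl coefMX scale0r add0r; apply: eq_bigr => j _.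
by rewrite coefMX /= addnS.
Qed.

Lemma shift_actXn n x i : shift_act 'X^n x i = x (i + n)%N.
Proof.
rewrite /shift_act size_polyXn big_ord_recr /= coefXn eqxx scale1r big1 ?add0r //.
by move=> j _; rewrite coefXn ltn_eqF ?scale0r.
Qed.

Lemma shift_actDr p x y i :
  shift_act p (fun i => x i + y i) i = shift_act p x i + shift_act p y i.
Proof. by rewrite -big_split; apply: eq_bigr => j _; rewrite scalerDr. Qed.

Lemma shift_actZr p c x i :
  shift_act p (fun i => c *: x i) i = c *: shift_act p x i.
Proof.
rewrite scaler_sumr; apply: eq_bigr => j _.
by rewrite !scalerA mulrC.
Qed.

Lemma eq_shift_act p x y i : x =1 y -> shift_act p x i = shift_act p y i.
Proof. by move=> eq_xy; apply: eq_bigr => j _; rewrite eq_xy. Qed.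

(** This turns division by a linear factor into a first-order recurrence. *)
Lemma shift_actMXsubC p a x i :
  shift_act (p * ('X - a%:P)) x i = shift_act p (fun i => x i.+1 - a *: x i) i.
Proof.
rewrite mulrBr mulrC [p * a%:P]mulrC mul_polyC mulrC -scaleNr.
rewrite shift_actDl shift_actMX shift_actZl -shift_actZr -shift_actDr.
by apply: eq_shift_act => j; rewrite scaleNr.
Qed.

End ShiftAction.

Lemma shift_act_mulmx (K : comNzRingType) (b c : nat) (p : {poly K})
    (x : nat -> 'rV[K]_b) (M : 'M[K]_(b, c)) i :
  shift_act p (fun i => x i *m M) i = shift_act p x i *m M.
Proof. by rewrite mulmx_suml; apply: eq_bigr => j _; rewrite scalemxAl. Qed.

(* Deflation at the root [a] of [\det Q]: if [Q v = ('X - a) q] with [v p = 1],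
   then replacing column [p] of [Q] by [q] divides the determinant by ['X - a]. *)
Lemma deflation (K : fieldType) (d : nat) (Q : 'M[{poly K}]_d) (a : K) :
  root (\det Q) a ->
  exists (p : 'I_d) (v : 'cV[K]_d) (q : 'cV[{poly K}]_d),
  [/\ v p 0 = 1, Q *m map_mx polyC v = ('X - a%:P) *: q &
      \det (\matrix_(i, j) if j == p then q i 0 else Q i j) * ('X - a%:P) =
      \det Q].
Proof.
rewrite /root -[_.[a]]/(horner_eval a _) -det_map_mx -det_tr => /det0P[w].
rewrite -trmx_eq0 => nz_w /(congr1 trmx); rewrite trmx_mul trmxK trmx0 => Qw0.
have [p nz_p] : exists p, w^T p 0 != 0.
  apply/existsP; apply: contraR nz_w; rewrite negb_exists => /forallP w0.
  by apply/eqP/matrixP => i j; rewrite ord1 [RHS]mxE; apply/eqP/negbNE.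
pose v := (w^T p 0)^-1 *: w^T.
have v_p : v p 0 = 1 by rewrite mxE mulVf.
have div_a i : exists q, (Q *m map_mx polyC v) i 0 = q * ('X - a%:P).
  apply/factor_theorem; rewrite /root -[_.[a]]/(horner_eval a _).
  have -> : horner_eval a ((Q *m map_mx polyC v) i 0) =
      (map_mx (horner_eval a) (Q *m map_mx polyC v)) i 0 by rewrite [RHS]mxE.
  rewrite map_mxM -map_mx_comp.
  have -> : map_mx (horner_eval a \o polyC) v = v.
    by apply/matrixP => r s; rewrite mxE /= /horner_eval hornerC.
  by rewrite -scalemxAr Qw0 scaler0 mxE.
have [q qP] := fin_all_exists div_a.
exists p, v, (\col_i q i); split=> //.
  by apply/matrixP => i j; rewrite ord1 qP !mxE mulrC.
(* [S] is the identity with column [p] replaced by [v]. Its determinant is [v p 0 = 1], and [Q *m S]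
   is the deflated matrix with column [p] scaled by ['X - a%:P]. *)
pose S : 'M[{poly K}]_d := \matrix_(i, j) if j == p then (v i 0)%:P else (i == j)%:R.
have detS : \det S = 1.
  rewrite (expand_det_row _ p) (bigD1 p) //= big1 => [|j ne_jp].
    rewrite mxE eqxx v_p mul1r addr0 /cofactor -signr_odd oddD addbb mul1r.
    rewrite (_ : row' p (col' p S) = 1%:M) ?det1 //.
    apply/matrixP => i j; rewrite !mxE eq_sym (negbTE (neq_lift _ _)).
    by rewrite (inj_eq lift_inj).
  by rewrite mxE (negbTE ne_jp) eq_sym (negbTE ne_jp) mul0r.
rewrite -[RHS]mulr1 -detS -det_mulmx.
pose D : 'M[{poly K}]_d := diag_mx (\row_j if j == p then 'X - a%:P else 1).
have detD : \det D = 'X - a%:P.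
  rewrite det_diag (bigD1 p) //= mxE eqxx big1 ?mulr1 // => j ne_jp.
  by rewrite mxE (negbTE ne_jp).
rewrite -detD -det_mulmx; congr (\det _); apply/matrixP => i j.
rewrite mul_mx_diag !mxE; case: ifP => [/eqP ->|ne_jp].
  by have := qP i; rewrite !mxE => <-; apply: eq_bigr => r _; rewrite !mxE eqxx.
rewrite mulr1 (bigD1 j) //= big1 ?addr0 => [|r ne_rj].
  by rewrite mxE ne_jp eqxx mulr1.
by rewrite mxE ne_jp (negbTE ne_rj) mulr0.
Qed.

Lemma normc_ge0 (R : rcfType) (z : R[i]) : 0 <= Normc.normc z.
Proof. by case: z => u v; rewrite /Normc.normc sqrtr_ge0. Qed.

(** * Independent decaying solutions built from the roots of the determinant *)

Section DecayingSolutions.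

Variables (R : rcfType) (rho : R).
Hypothesis rho_gt0 : 0 < rho.

(** The constant [D] satisfies [|a| D + C <= rho D], which closes the induction. *)
Lemma geometric_recurrence (a : R[i]) (x f : nat -> R[i]) (C : R) :
  Normc.normc a < rho ->
  (forall i, x i.+1 = a * x i + f i) ->
  (forall i, Normc.normc (f i) <= C * rho ^+ i) ->
  forall i, Normc.normc (x i) <=
    (Normc.normc (x 0%N) + C / (rho - Normc.normc a)) * rho ^+ i.
Proof.
move=> lt_a x_rec f_le; set D := _ + _.
have gap : 0 < rho - Normc.normc a by rewrite subr_gt0.
have C_ge0 : 0 <= C by have := le_trans (normc_ge0 _) (f_le 0%N); rewrite mulr1.
have D_C : C <= D * (rho - Normc.normc a).
  by rewrite mulrDl divfK ?gt_eqF // lerDr mulr_ge0 ?normc_ge0 // ltW.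
elim=> [|i IH]; first by rewrite expr0 mulr1 lerDl divr_ge0 // ltW.
rewrite x_rec; apply: (le_trans (le_normcD _ _)); rewrite Normc.normcM.
have := ler_wpM2l (normc_ge0 a) IH; have := f_le i.
have := ler_wpM2r (exprn_ge0 i (ltW rho_gt0)) D_C; rewrite exprS; nra.
Qed.

(** Entry [t] of [U r i] is coordinate [r] at time [i] of solution number [t], so the last clause is
    linear independence. By induction on [s], solutions for the deflated matrix lift to [Q] and one
    new solution is added. *)
Lemma decaying_solutions (d : nat) (s : seq R[i]) (Q : 'M[{poly R[i]}]_d) :
  all (fun a => Normc.normc a < rho) s ->
  \prod_(a <- s) ('X - a%:P) %| \det Q ->
  exists U : 'I_d -> nat -> 'rV[R[i]]_(size s),
    [/\ exists C, forall r i t, Normc.normc (U r i 0 t) <= C * rho ^+ i,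
        forall r i, \sum_l shift_act (Q r l) (U l) i = 0 &
        forall y : 'cV[R[i]]_(size s), (forall r i, U r i *m y = 0) -> y = 0].
Proof.
elim: s Q => [|a s IH] Q /= => [_ _|/andP[lt_a s_in]].
  exists (fun _ _ => 0); split.
  - by exists 0 => r i [].
  - by move=> r i; rewrite big1 // => l _; rewrite /shift_act big1 // => j _;
      rewrite scaler0.
  - by move=> y _; apply/matrixP => -[].
rewrite big_cons => dvd_Q.
have /deflation[p [v [q [v_p Qv detQ']]]] : root (\det Q) a.
  by rewrite -dvdp_XsubCl (dvdp_trans _ dvd_Q) ?dvdp_mulr.
set Q' := \matrix_(i, j) _ in detQ'.
have /(IH Q' s_in)[U [[C U_le] U_sol U_free]] :
    \prod_(b <- s) ('X - b%:P) %| \det Q'.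
  by rewrite -(@dvdp_mul2l _ ('X - a%:P)) ?polyXsubC_eq0 // [X in _ %| X]mulrC detQ'.
(* [x] solves [x (i+1) - a x i = U p i], extended to one more column. *)
pose ext l i : 'rV[R[i]]_(1 + size s) := row_mx 0 (U l i).
pose x := fix x i : 'rV[R[i]]_(1 + size s) :=
  if i is i'.+1 then a *: x i' + ext p i' else row_mx 1%:M 0.
(* Coordinate [p] of the old solution enters only through [x]: since [Q v = ('X - a) q] and ['X - a]
   acts on [x] to give [ext p], the term [v x] contributes [q] acting on [ext p]. In the extra
   entry, [W] is the new solution [a ^+ i *: v]. *)
pose W l i : 'rV[R[i]]_(1 + size s) :=
  (if l == p then 0 else ext l i) + v l 0 *: x i.
exists W; split.
(* [C] may be negative when there are no old solutions, hence the maximum with 0. *)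
- have ext_le l i t : Normc.normc (ext l i 0 t) <= Num.max 0 C * rho ^+ i.
    have pow_ge0 := exprn_ge0 i (ltW rho_gt0).
    rewrite /ext mxE; case: split => t'.
      by rewrite mxE Normc.normc0 mulr_ge0 // le_max lexx.
    by rewrite (le_trans (U_le _ _ _)) // ler_wpM2r // le_max lexx orbT.
  set C0 := Num.max 0 C in ext_le.
  pose D := 1 + C0 / (rho - Normc.normc a).
  have D_ge0 : 0 <= D.
    by rewrite addr_ge0 ?ler01 // divr_ge0 ?le_max ?lexx // subr_ge0 ltW.
  have x_le i t : Normc.normc (x i 0 t) <= D * rho ^+ i.
    have x_rec j : x j.+1 0 t = a * x j 0 t + ext p j 0 t by rewrite /= !mxE.
    apply: (le_trans (geometric_recurrence lt_a x_rec (fun j => ext_le p j t) i)).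
    rewrite ler_wpM2r ?exprn_ge0 ?(ltW rho_gt0) // lerD2r.
    rewrite mxE; case: split => t'; rewrite mxE ?Normc.normc0 ?ler01 //.
    by rewrite !ord1 Normc.normc1.
  pose E := C0 + (\sum_l Normc.normc (v l 0)) * D.
  exists E => r i t; rewrite !mxE.
  have pow_ge0 := exprn_ge0 i (ltW rho_gt0).
  rewrite (le_trans (le_normcD _ _)) // mulrDl lerD //.
    case: eqP => _; last exact: ext_le.
    by rewrite mxE Normc.normc0 mulr_ge0 // le_max lexx.
  rewrite Normc.normcM -mulrA ler_pM ?mulr_ge0 ?normc_ge0 // (bigD1 r) //= lerDl.
  by rewrite sumr_ge0 // => l _; exact: normc_ge0.
- move=> r i; rewrite (bigD1 p) //=.
  have split_sum : \sum_(l | l != p) shift_act (Q r l) (W l) i =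
      \sum_(l | l != p) shift_act (Q r l) (ext l) i +
      \sum_(l | l != p) v l 0 *: shift_act (Q r l) x i.
    rewrite -big_split; apply: eq_bigr => l /negbTE ne_lp /=.
    rewrite -shift_actZr -shift_actDr; apply: eq_shift_act => j.
    by rewrite /W ne_lp.
  have Wp : shift_act (Q r p) (W p) i = v p 0 *: shift_act (Q r p) x i.
    by rewrite -shift_actZr; apply: eq_shift_act => j; rewrite /W eqxx add0r.
  rewrite split_sum Wp addrCA -(bigD1 p (P := predT)) //=.
  have -> : \sum_l v l 0 *: shift_act (Q r l) x i = shift_act (q r 0) (ext p) i.
    transitivity (shift_act (q r 0 * ('X - a%:P)) x i); last first.
      by rewrite shift_actMXsubC; apply: eq_shift_act => j; rewrite /= addrC addKr.
    have := congr1 (fun M : 'cV[{poly R[i]}]_d => M r 0) Qv.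
    rewrite !mxE mulrC => <-.
    rewrite shift_act_suml; apply: eq_bigr => l _.
    by rewrite -shift_actZl mxE mulrC mul_polyC.
  have : \sum_l shift_act (Q' r l) (ext l) i = 0.
    transitivity
      ((\sum_l shift_act (Q' r l) (U l) i) *m row_mx (0 : 'M_(_, 1)) 1%:M).
      rewrite mulmx_suml; apply: eq_bigr => l _; rewrite -shift_act_mulmx.
      by apply: eq_shift_act => j; rewrite mul_mx_row mulmx0 mulmx1.
    by rewrite U_sol mul0mx.
  rewrite (bigD1 p) //= mxE eqxx addrC => sum0; rewrite -[RHS]sum0.
  by congr (_ + _); apply: eq_bigr => l /negbTE ne_lp; rewrite mxE ne_lp.
- move=> y Wy0.
  (* Coordinate [p] of [W] is [x] itself, and the recurrence of [x] recovers [ext p]; so all old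
     solutions vanish against [y], and [x 0] removes the extra entry. *)
  have xy0 i : x i *m y = 0.
    by have := Wy0 p i; rewrite /W eqxx add0r v_p scale1r.
  have exty0 l i : ext l i *m y = 0.
    have [->|ne_lp] := eqVneq l p.
      by have := xy0 i.+1; rewrite /= mulmxDl -scalemxAl xy0 scaler0 add0r.
    have := Wy0 l i; rewrite /W (negbTE ne_lp) mulmxDl -scalemxAl xy0.
    by rewrite scaler0 addr0.
  rewrite -[y](@vsubmxK _ 1 (size s) 1) in exty0 xy0 *.
  have -> : dsubmx (y : 'cV_(1 + size s)) = 0.
    by apply: U_free => l i; have := exty0 l i; rewrite mul_row_col mul0mx add0r.
  have := xy0 0%N; rewrite mul_row_col mul1mx mul0mx addr0 => ->.
  by rewrite col_mx0.
Qed.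

End DecayingSolutions.

(** * Dominant coefficients in an induced norm *)

Lemma bernoulli (R : realDomainType) (a : R) (n : nat) :
  0 <= a -> 1 + n%:R * (a - 1) <= a ^+ n.
Proof.
move=> a_ge0; elim: n => [|n IH]; first by rewrite mul0r addr0.
rewrite exprS; have := ler_wpM2l a_ge0 IH; have := sqr_ge0 (a - 1).
have : 0 <= n%:R :> R by rewrite ler0n.
by rewrite -natr1; nra.
Qed.

Lemma geometric_le0 (R : archiRealFieldType) (x C theta : R) :
  theta < 1 -> 0 <= theta -> (forall n, x <= C * theta ^+ n) -> x <= 0.
Proof.
move=> lt1 ge0 x_le; rewrite leNgt; apply/negP => x_gt0.
have C_gt0 : 0 < C by have := x_le 0%N; rewrite mulr1; apply: lt_le_trans.
have [t0|t_gt0] := eqVneq theta 0.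
  by have := x_le 1%N; rewrite t0 mulr0 leNgt x_gt0.
have {ge0}t_gt0 : 0 < theta by rewrite lt_neqAle eq_sym t_gt0.
pose e := theta^-1 - 1.
have e_gt0 : 0 < e by rewrite subr_gt0 invf_gt1.
(* With [theta^-1 = 1 + e], Bernoulli gives growth at least [1 + n e], which exceeds [C / x] for
   this [n]. *)
pose n := Num.bound (C / (x * e)).
have n_gt : C / (x * e) < n%:R.
  by apply: archi_boundP; rewrite divr_ge0 ?ltW // mulr_gt0.
rewrite ltr_pdivrMr ?mulr_gt0 // in n_gt.
have pow_ge : 1 + n%:R * e <= (theta ^+ n)^-1.
  by rewrite -exprVn bernoulli // invr_ge0 ltW.
have pow_gt0 : 0 < theta ^+ n by rewrite exprn_gt0.
have := x_le n; rewrite -ler_pdivrMr // => x_pow.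
have := ler_wpM2l (ltW x_gt0) pow_ge; nra.
Qed.

Section InducedNorm.

Variables (R : realType) (d : nat).
Variables (N : 'cV[R[i]]_d -> R) (nu : 'M[R[i]]_d -> R).
Hypotheses (normN : vector_norm N) (nuP : induced_norm N nu).

Lemma vnorm_ge0 v : 0 <= N v. Proof. by case: normN. Qed.

Lemma vnormZ a v : N (a *: v) = Normc.normc a * N v.
Proof. by case: normN. Qed.

Lemma vnorm0 : N 0 = 0.
Proof. by rewrite -(scale0r (0 : 'cV[R[i]]_d)) vnormZ Normc.normc0 mul0r. Qed.

Lemma vnormN v : N (- v) = N v.
Proof. by rewrite -scaleN1r vnormZ normcN Normc.normc1 mul1r. Qed.

Lemma vnorm_sum (I : Type) (r : seq I) (P : pred I) (F : I -> 'cV[R[i]]_d) :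
  N (\sum_(i <- r | P i) F i) <= \sum_(i <- r | P i) N (F i).
Proof.
have [_ _ _ N_D] := normN.
elim/big_rec2: _ => [|i x y _ IH]; first by rewrite vnorm0.
by rewrite (le_trans (N_D _ _)) // lerD2l.
Qed.

Lemma nu_ge0 A : 0 <= nu A.
Proof. by have [[v _ ->] _] := nuP A; exact: vnorm_ge0. Qed.

Lemma vnorm_mulmx A v : N (A *m v) <= nu A * N v.
Proof.
have [Nv0|Nv_neq0] := eqVneq (N v) 0.
  by have [_ /(_ v Nv0) -> _ _] := normN; rewrite mulmx0 vnorm0 mulr0.
have Nv_gt0 : 0 < N v by rewrite lt_neqAle eq_sym Nv_neq0 vnorm_ge0.
have normc_real (x : R) : 0 <= x -> Normc.normc (x%:C)%C = x.
  by move=> x_ge0; rewrite /Normc.normc /= expr0n addr0 sqrtr_sqr ger0_norm.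
have [_ /(_ (((N v)^-1)%:C%C *: v))] := nuP A.
rewrite -scalemxAr !vnormZ normc_real ?invr_ge0 ?vnorm_ge0 // mulVf // => /(_ erefl).
by rewrite mulrC ler_pdivrMr.
Qed.

Lemma nu1 : nu 1%:M = 1.
Proof. by have [[v Nv ->] _] := nuP 1%:M; rewrite mul1mx. Qed.

Lemma nu_gt0 A : A != 0 -> 0 < nu A.
Proof.
move=> nz_A; rewrite lt_neqAle nu_ge0 andbT eq_sym; apply: contraNneq nz_A => nu0.
apply/eqP/matrixP => i j.
have : A *m (delta_mx j 0 : 'cV_d) = 0.
  have [_ N_eq0 _ _] := normN; apply: N_eq0; apply/eqP.
  by rewrite eq_le vnorm_ge0 andbT -[leRHS](mul0r (N (delta_mx j 0))) -nu0
    vnorm_mulmx.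
by move=> /(congr1 (fun M : 'cV_d => M i 0)); rewrite -colE !mxE.
Qed.

Lemma nu_invmx_le A v : A \in unitmx -> (nu (invmx A))^-1 * N v <= N (A *m v).
Proof.
move=> uA; have [->|nu_neq0] := eqVneq (nu (invmx A)) 0.
  by rewrite invr0 mul0r vnorm_ge0.
have nu_gt0 : 0 < nu (invmx A) by rewrite lt_neqAle eq_sym nu_neq0 nu_ge0.
by rewrite mulrC ler_pdivrMr // mulrC -{1}[v](mulKmx uA) vnorm_mulmx.
Qed.

(** The identity attains its norm 1 at a unit vector, so the zero matrix cannot be an inverse, as it
    could in dimension 0. *)
Lemma nu_invmx_gt0 A : A \in unitmx -> 0 < nu (invmx A).
Proof.
move=> uA; apply: nu_gt0; apply: contraTneq isT => inv0.
have := nu1; rewrite -(mulmxV uA) inv0 mulmx0 => nu01.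
have [[v Nv nu0] _] := nuP 0; move: nu0; rewrite mul0mx vnorm0 nu01 => /eqP.
by rewrite oner_eq0.
Qed.

(** * Recurrences with one dominant coefficient *)

Section Recurrence.

Variables (h k : nat) (C : nat -> 'M[R[i]]_d).
Hypotheses (le_kh : (k <= h)%N) (Ck_unit : C k \in unitmx).

(** Isolating the term [k] covers both uses: [u j = z ^+ j *: v] for an eigenvector, and a shifted
    solution for the contraction. *)
Lemma recurrence_le (u : nat -> 'cV[R[i]]_d) :
  \sum_(j < h.+1) C j *m u j = 0 ->
  (nu (invmx (C k)))^-1 * N (u k) <=
    \sum_(j < h.+1 | j != k :> nat) nu (C j) * N (u j).
Proof.
have lt_kh : (k < h.+1)%N by [].
rewrite (bigD1 (Ordinal lt_kh)) //= => /eqP; rewrite addr_eq0 => /eqP Cu.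
rewrite (le_trans (nu_invmx_le _ Ck_unit)) // Cu vnormN.
by rewrite (le_trans (vnorm_sum _ _ _)) // ler_sum // => j _; exact: vnorm_mulmx.
Qed.

Lemma eigenvalue_le (z : R[i]) (v : 'cV[R[i]]_d) :
  v != 0 -> \sum_(j < h.+1) z ^+ j *: (C j *m v) = 0 ->
  (nu (invmx (C k)))^-1 * Normc.normc z ^+ k <=
    \sum_(j < h.+1 | j != k :> nat) nu (C j) * Normc.normc z ^+ j.
Proof.
move=> nz_v Qzv.
have normcX j : Normc.normc (z ^+ j) = Normc.normc z ^+ j.
  by elim: j => [|j IH]; rewrite ?Normc.normc1 // !exprS Normc.normcM IH.
have Nv_gt0 : 0 < N v.
  rewrite lt_neqAle vnorm_ge0 andbT eq_sym; apply: contraNneq nz_v => Nv0.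
  by apply/eqP; case: normN => _ N_eq0 _ _; exact: N_eq0.
rewrite -(ler_pM2r Nv_gt0) mulr_suml.
have := @recurrence_le (fun j => z ^+ j *: v) _.
rewrite (eq_bigr _ (fun (j : 'I__) _ => esym (scalemxAr (z ^+ j) (C j) v))).
move=> /(_ Qzv); rewrite vnormZ normcX mulrA => /le_trans -> //.
by apply: ler_sum => j _; rewrite vnormZ normcX mulrA.
Qed.

Variable rho : R.
Hypotheses (rho_gt0 : 0 < rho)
  (dominant : \sum_(j < h.+1 | j != k :> nat) nu (C j) * rho ^+ j <
              (nu (invmx (C k)))^-1 * rho ^+ k).

(* A solution of the recurrence that is O(rho^i) is determined by its first [k]
   terms: solving for the dominant term is a contraction for the weighted
   supremum norm. *)
Lemma recurrence_eq0 (D : R) (u : nat -> 'cV[R[i]]_d) :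
  (forall i, \sum_(j < h.+1) C j *m u (i + j)%N = 0) ->
  (forall i, N (u i) <= D * rho ^+ i) ->
  (forall i, (i < k)%N -> u i = 0) ->
  forall i, u i = 0.
Proof.
move=> u_sol u_le u0 i.
pose S := \sum_(j < h.+1 | j != k :> nat) nu (C j) * rho ^+ j.
pose c := (nu (invmx (C k)))^-1.
have dom : S < c * rho ^+ k by exact: dominant.
have pow_gt0 j : 0 < rho ^+ j by rewrite exprn_gt0.
have S_ge0 : 0 <= S.
  by apply: sumr_ge0 => j _; rewrite mulr_ge0 ?nu_ge0 // ltW.
have den_gt0 : 0 < c * rho ^+ k by apply: le_lt_trans dom.
have c_gt0 : 0 < c by rewrite -(pmulr_lgt0 _ (pow_gt0 k)).
pose theta := S / (c * rho ^+ k).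
have theta_ge0 : 0 <= theta by rewrite divr_ge0 // ltW.
have theta_lt1 : theta < 1 by rewrite ltr_pdivrMr // mul1r.
have D_ge0 : 0 <= D by have := le_trans (vnorm_ge0 _) (u_le 0%N); rewrite mulr1.
have contract n l : N (u l) <= D * theta ^+ n * rho ^+ l.
  elim: n l => [|n IH] l; first by rewrite mulr1.
  have B_ge0 p : 0 <= D * theta ^+ p * rho ^+ l.
    by rewrite !mulr_ge0 ?exprn_ge0 // ltW.
  have [lt_lk|le_kl] := ltnP l k; first by rewrite u0 // vnorm0.
  (* The equation at time [l - k] has [u l] as its dominant term; bounding the other terms by the
     previous round gains one factor [theta]. *)
  have := @recurrence_le (fun j => u (l - k + j)%N) (u_sol _).
  rewrite subnK // -/c => cN_le.
  rewrite -(ler_pM2l c_gt0) (le_trans cN_le) //.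
  have theta_c : theta * c * rho ^+ k = S.
    by rewrite -mulrA divfK ?gt_eqF.
  have -> : c * (D * theta ^+ n.+1 * rho ^+ l) =
      D * theta ^+ n * rho ^+ (l - k) * S.
    rewrite -theta_c -{1}(subnK le_kl) exprD exprS; ring.
  rewrite mulr_sumr ler_sum // => j _.
  rewrite (le_trans (ler_wpM2l (nu_ge0 _) (IH _))) // exprD.
  by rewrite le_eqVlt; apply/orP; left; apply/eqP; ring.
have [_ N_eq0 _ _] := normN; apply: N_eq0; apply/eqP.
rewrite eq_le vnorm_ge0 andbT.
apply: (geometric_le0 (C := D * rho ^+ i) theta_lt1 theta_ge0) => n.
by rewrite mulrAC contract.
Qed.

(** With more than [k * d] independent decaying solutions, some nontrivial combination would have
    its first [k] terms zero, hence vanish altogether. *)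
Lemma size_dominated_roots (s : seq R[i]) :
  all (fun a => Normc.normc a < rho) s ->
  \prod_(a <- s) ('X - a%:P) %| \det (\sum_(j < h.+1) 'X^j *: map_mx polyC (C j)) ->
  (size s <= k * d)%N.
Proof.
move=> s_in /(decaying_solutions rho_gt0 s_in)[U [[D U_le] U_sol U_free]].
rewrite leqNgt; apply/negP => lt_s.
pose M i : 'M[R[i]]_(d, size s) := \matrix_(r, t) U r i 0 t.
have MU i (y : 'cV_(size s)) r : (M i *m y) r 0 = (U r i *m y) 0 0.
  by rewrite !mxE; apply: eq_bigr => t _; rewrite mxE.
have [y nz_y My0] : exists2 y : 'cV_(size s), y != 0 &
    forall i, (i < k)%N -> M i *m y = 0.
  (* [T] stacks the first [k] terms: [k * d] rows against [size s] columns, so it has a nonzero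
     kernel vector. *)
  pose T := \mxcol_(i < k) M i.
  have : kermx T^T != 0.
    rewrite -mxrank_eq0 mxrank_ker subn_eq0 -ltnNge mxrank_tr.
    by rewrite (leq_ltn_trans (rank_leq_row _)) // sum_nat_const card_ord.

  case/rowV0Pn => w /sub_kermxP wT nz_w; exists w^T; first by rewrite trmx_eq0.
  move=> i lt_ik; have : T *m w^T = 0 by rewrite -[T]trmxK -trmx_mul wT trmx0.
  rewrite mxcol_mul => /(congr1 (fun A => submxcol A (Ordinal lt_ik))).
  by rewrite mxcolK submxcol0.
case/eqP: nz_y; apply: U_free => r i; apply/matrixP => p q; rewrite !ord1 -MU.
suff -> : M i *m y = 0 by rewrite !mxE.
(* Expanding in the standard basis converts the entrywise bound [D] into one for [N]. *)
pose E := D * (\sum_t Normc.normc (y t 0)) * \sum_r N (delta_mx r 0).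
apply: (@recurrence_eq0 E (fun i => M i *m y)) => // [{}i|{}i].
  apply/matrixP => {}r {}q; rewrite ord1 [RHS]mxE summxE.
  have /(congr1 (fun w : 'rV_(size s) => (w *m y) 0 0)) := U_sol r i.
  rewrite mul0mx [RHS]mxE => sum0; rewrite -[RHS]sum0 mulmx_suml summxE.
  under eq_bigr do rewrite mxE.
  rewrite exchange_big /=; apply: eq_bigr => l _.
  rewrite summxE shift_act_suml mulmx_suml summxE; apply: eq_bigr => j _.
  have -> : ('X^j *: map_mx polyC (C j)) r l = C j r l *: 'X^j.
    by rewrite !mxE mulrC mul_polyC.
  by rewrite shift_actZl shift_actXn -scalemxAl [RHS]mxE MU.
- have -> : M i *m y = \sum_r (M i *m y) r 0 *: delta_mx r 0.
    by rewrite {1}[M i *m y]matrix_sum_delta; apply: eq_bigr => l _;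
      rewrite big_ord1.
  rewrite (le_trans (vnorm_sum _ _ _)) // /E mulrAC mulr_sumr.
  apply: ler_sum => l _; rewrite vnormZ ler_wpM2r ?vnorm_ge0 // mxE.
  rewrite mulrAC mulr_sumr.
  elim/big_rec2: _ => [|t z1 z2 _ IH]; first by rewrite Normc.normc0.
  rewrite (le_trans (le_normcD _ _)) // lerD // Normc.normcM.
  by rewrite ler_wpM2r ?normc_ge0 // mxE.
Qed.

End Recurrence.

End InducedNorm.

(** * Real comparison polynomials *)

Section RealComparison.

Variables (R : realFieldType) (b : nat -> R).
Hypothesis b_ge0 : forall j, 0 <= b j.

(* Bernoulli's inequality makes [y^(j-k)] strictly smaller than a weighted mean
   of [y1^(j-k)] and [y2^(j-k)] for all [j <> k] at once; this works as soon as
   the weights have a ratio strictly between those giving equality for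
   [j = k + 1] and for [j = k - 1]. *)
Lemma weighted_pow_lt (k : nat) (y1 y y2 : R) :
  0 < y1 -> y1 < y -> y < y2 ->
  exists w1 w2 w : R, [/\ 0 < w1, 0 < w2, 0 < w,
    w * y ^+ k = w1 * y1 ^+ k + w2 * y2 ^+ k &
    forall j, j != k -> w * y ^+ j < w1 * y1 ^+ j + w2 * y2 ^+ j].
Proof.
move=> y1_gt0 lt1 lt2; have y_gt0 := lt_trans y1_gt0 lt1.
have y2_gt0 := lt_trans y_gt0 lt2.
pose a := y1 / y; pose t := y2 / y.
have a_gt0 : 0 < a by rewrite divr_gt0.
have t_gt0 : 0 < t by rewrite divr_gt0.
have a_lt1 : a < 1 by rewrite ltr_pdivrMr // mul1r.
have t_gt1 : 1 < t by rewrite ltr_pdivlMr // mul1r.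
have y1E : y1 = a * y by rewrite divfK ?gt_eqF.
have y2E : y2 = t * y by rewrite divfK ?gt_eqF.
(* The ratio of weights is proportional to [q]: [q = 1] gives equality at [k + 1] and [q = a / t] at
   [k - 1], so the midpoint is taken. *)
clearbody a t; pose q := (1 + a / t) / 2%:R.
have at_lt1 : a / t < 1 by rewrite ltr_pdivrMr // mul1r (lt_trans a_lt1).
have q_lt1 : q < 1 by rewrite /q; lra.
have q_gt : a / t < q by rewrite /q; lra.
have q_gt0 : 0 < q by rewrite (lt_trans _ q_gt) // divr_gt0.
pose l1 := q * (t - 1); pose l2 := 1 - a.
have l1_gt0 : 0 < l1 by rewrite mulr_gt0 // subr_gt0.
have l2_gt0 : 0 < l2 by rewrite subr_gt0.
have up e : (0 < e)%N -> l1 + l2 < l1 * a ^+ e + l2 * t ^+ e.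
  move=> e_gt0; have := ler_wpM2l (ltW l1_gt0) (bernoulli e (ltW a_gt0)).
  have := ler_wpM2l (ltW l2_gt0) (bernoulli e (ltW t_gt0)).
  have slope : 0 < e%:R * (l1 * (a - 1) + l2 * (t - 1)).
    rewrite mulr_gt0 ?ltr0n //.
    have -> : l1 * (a - 1) + l2 * (t - 1) = (1 - a) * (t - 1) * (1 - q).
      by rewrite /l1 /l2; ring.
    by rewrite !mulr_gt0 ?subr_gt0.
  move: slope; set z := e%:R; lra.
have down e : (0 < e)%N -> l1 + l2 < l1 * a^-1 ^+ e + l2 * t^-1 ^+ e.
  have ai_ge0 : 0 <= a^-1 by rewrite invr_ge0 ltW.
  have ti_ge0 : 0 <= t^-1 by rewrite invr_ge0 ltW.
  move=> e_gt0; have := ler_wpM2l (ltW l1_gt0) (bernoulli e ai_ge0).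
  have := ler_wpM2l (ltW l2_gt0) (bernoulli e ti_ge0).
  have slope : 0 < e%:R * (l1 * (a^-1 - 1) + l2 * (t^-1 - 1)).
    rewrite mulr_gt0 ?ltr0n //.
    have -> : l1 * (a^-1 - 1) + l2 * (t^-1 - 1) =
        (1 - a) * (t - 1) * ((q - a / t) / a).
      by rewrite /l1 /l2; field; rewrite !gt_eqF.
    by rewrite !mulr_gt0 ?subr_gt0 // invr_gt0.
  move: slope; set z := e%:R; lra.
have pow_gt0 j : 0 < y ^+ j by rewrite exprn_gt0.
(* Dividing by [a ^+ k] and [t ^+ k] makes the mean exact at exponent [k]. *)
exists (l1 / a ^+ k), (l2 / t ^+ k), (l1 + l2); split.
- by rewrite divr_gt0 ?exprn_gt0.
- by rewrite divr_gt0 ?exprn_gt0.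
- by rewrite addr_gt0.
- rewrite y1E y2E !exprMn !mulrA !divfK ?mulrDl // gt_eqF // exprn_gt0 //.
move=> j; rewrite y1E y2E !exprMn; rewrite neq_ltn => /orP[lt_jk|lt_kj].
  have := down (k - j)%N; rewrite subn_gt0 lt_jk => /(_ isT).
  rewrite -(ltr_pM2r (pow_gt0 j)) => /lt_le_trans -> //.
  have splitk (z : R) : z ^+ k = z ^+ (k - j) * z ^+ j
    by rewrite -exprD subnK // ltnW.
  rewrite !exprVn !splitk le_eqVlt; apply/orP; left; apply/eqP; field.
  by rewrite !gt_eqF // exprn_gt0.
have := up (j - k)%N; rewrite subn_gt0 lt_kj => /(_ isT).
rewrite -(ltr_pM2r (pow_gt0 j)) => /lt_le_trans -> //.
have splitj (z : R) : z ^+ j = z ^+ (j - k) * z ^+ k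
  by rewrite -exprD subnK // ltnW.
rewrite (splitj a) (splitj t) le_eqVlt; apply/orP; left; apply/eqP; field.
by rewrite !gt_eqF // exprn_gt0.
Qed.

(** The mean is exact at exponent [k], so the two equations combine with weights [w1] and [w2];
    strictness comes from the term [h], where [b h > 0]. *)
Lemma pellet_neg (h k : nat) (c y1 y y2 : R) :
  0 < b h -> h != k -> 0 < y1 -> y1 < y -> y < y2 ->
  \sum_(j < h.+1 | j != k :> nat) b j * y1 ^+ j = c * y1 ^+ k ->
  \sum_(j < h.+1 | j != k :> nat) b j * y2 ^+ j = c * y2 ^+ k ->
  \sum_(j < h.+1 | j != k :> nat) b j * y ^+ j < c * y ^+ k.
Proof.
move=> bh_gt0 ne_hk y1_gt0 lt1 lt2 e1 e2.
have [w1 [w2 [w [w1_gt0 w2_gt0 w_gt0 wk wj]]]] := weighted_pow_lt k y1_gt0 lt1 lt2.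
rewrite -(ltr_pM2l w_gt0) [ltRHS]mulrCA wk mulrDr.
rewrite mulrCA -e1 [c * (w2 * _)]mulrCA -e2 !mulr_sumr -big_split /=.
rewrite (bigD1 ord_max) //= [ltRHS](bigD1 ord_max) //=.
apply: ltr_leD.
  by rewrite !(mulrCA _ (b h)) -mulrDr ltr_pM2l // wj.
apply: ler_sum => j /andP[ne_jk _].
by rewrite !(mulrCA _ (b j)) -mulrDr ler_wpM2l // ltW // wj.
Qed.

(** Scaling [x] by [r > 1] multiplies the right side by [r ^+ h] but each term on the left by at
    most [r ^+ h.-1]. *)
Lemma cauchy_mono (h : nat) (x y : R) :
  (0 < h)%N -> 0 < x -> x < y ->
  \sum_(0 <= j < h) b j * x ^+ j <= x ^+ h ->
  \sum_(0 <= j < h) b j * y ^+ j < y ^+ h.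
Proof.
case: h => // h _ x_gt0 lt_xy le_x; pose r := y / x.
have r_gt1 : 1 < r by rewrite ltr_pdivlMr // mul1r.
have r_gt0 : 0 < r by apply: lt_trans r_gt1.
have -> : y = r * x by rewrite divfK ?gt_eqF.
clearbody r.
apply: (@le_lt_trans _ _ (r ^+ h * \sum_(0 <= j < h.+1) b j * x ^+ j)).
  rewrite mulr_sumr; apply: ler_sum_nat => j /= lt_jh.
  rewrite mulrCA exprMn ler_wpM2l // ler_wpM2r ?exprn_ge0 ?(ltW x_gt0) //.
  by rewrite ler_weXn2l // ltW.
apply: le_lt_trans (ler_wpM2l (exprn_ge0 h (ltW r_gt0)) le_x) _.
by rewrite exprMn ltr_pM2r ?exprn_gt0 // exprS ltr_pMl // exprn_gt0.
Qed.

End RealComparison.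

(** * Existence of positive roots by the intermediate value theorem *)

Section PositiveRoots.

Variables (R : rcfType) (b : nat -> R) (h : nat).
Hypotheses (b_ge0 : forall j, 0 <= b j) (h_gt0 : (0 < h)%N).

Lemma horner_sum_monomials (m n : nat) (x : R) :
  (\sum_(m <= j < n) b j *: 'X^j).[x] = \sum_(m <= j < n) b j * x ^+ j.
Proof. by rewrite horner_sum; apply: eq_bigr => j _; rewrite hornerZ hornerXn. Qed.

Lemma cauchy_upper_root :
  (exists2 j, (j < h)%N & 0 < b j) ->
  exists x, 0 < x /\ root ('X^h - \sum_(0 <= j < h) b j *: 'X^j) x.
Proof.
case=> l lt_lh bl_gt0; set p := _ - _.
have pE x : p.[x] = x ^+ h - \sum_(0 <= j < h) b j * x ^+ j.
  by rewrite /p hornerD hornerN hornerXn horner_sum_monomials.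
(* At [e], [e ^+ h <= e ^+ l.+1 <= b l * e ^+ l]; at [M], the sum is at most [M ^+ h]. The positive
   endpoint [e] excludes a possible root at 0. *)
pose e := Num.min 1 (b l); pose M := 1 + \sum_(0 <= j < h) b j.
have e_gt0 : 0 < e by rewrite lt_min ltr01.
have e_le1 : e <= 1 by rewrite ge_min lexx.
have e_leb : e <= b l by rewrite ge_min lexx orbT.
have S_ge0 : 0 <= \sum_(0 <= j < h) b j by apply: sumr_ge0.
have M_ge1 : 1 <= M by rewrite lerDl.
have p_e : p.[e] <= 0.
  rewrite pE subr_le0; apply: (@le_trans _ _ (b l * e ^+ l)).
    rewrite (@le_trans _ _ (e ^+ l.+1)) ?ler_wiXn2l ?(ltW e_gt0) //.
    by rewrite exprS ler_wpM2r ?exprn_ge0 // ltW.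
  rewrite big_mkord (bigD1 (Ordinal lt_lh)) //= lerDl.
  by apply: sumr_ge0 => j _; rewrite mulr_ge0 ?exprn_ge0 // ltW.
have p_M : 0 <= p.[M].
  rewrite pE subr_ge0.
  case: (h) h_gt0 @M M_ge1 S_ge0 {p_e pE p} => // h' _ M M_ge1 S_ge0.
  have M_ge0 : 0 <= M by apply: le_trans M_ge1.
  rewrite (@le_trans _ _ ((\sum_(0 <= j < h'.+1) b j) * M ^+ h')) //.
    rewrite mulr_suml; apply: ler_sum_nat => j /= lt_j.
    by rewrite ler_wpM2l // ler_weXn2l.
  by rewrite exprS ler_wpM2r ?exprn_ge0 // lerDr.
have [x /andP[le_ex _] px] :
    exists2 x, e <= x <= M & root p x.
  by apply: poly_ivt; rewrite ?p_e // (le_trans e_le1).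
by exists x; split; rewrite // (lt_le_trans e_gt0).
Qed.

Lemma cauchy_lower_root (c : R) :
  0 < c ->
  exists x, 0 < x /\ root ('X^h + \sum_(1 <= j < h) b j *: 'X^j - c%:P) x.
Proof.
move=> c_gt0; set p := _ - _.
have pE x : p.[x] = x ^+ h + \sum_(1 <= j < h) b j * x ^+ j - c.
  by rewrite /p !hornerE horner_sum_monomials.
have p0 : p.[0] = - c.
  rewrite pE expr0n eqn0Ngt h_gt0 add0r big_nat_cond big1 ?add0r // => j.
  by rewrite andbT => /andP[j_gt0 _]; rewrite expr0n eqn0Ngt j_gt0 mulr0.
have c1_ge1 : 1 <= 1 + c by rewrite lerDl ltW.
have p1 : 0 <= p.[1 + c].
  have S_ge0 : 0 <= \sum_(1 <= j < h) b j * (1 + c) ^+ j.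
    by apply: sumr_ge0 => j _; rewrite mulr_ge0 ?exprn_ge0 // (le_trans _ c1_ge1).
  have := ler_eXnr h_gt0 c1_ge1; rewrite pE; lra.
have [x /andP[x_ge0 _] px] : exists2 x, 0 <= x <= 1 + c & root p x.
  by apply: poly_ivt; rewrite ?p0 ?oppr_le0 ?(ltW c_gt0) // (le_trans _ c1_ge1).
exists x; split=> //; rewrite lt_neqAle x_ge0 andbT eq_sym.
by apply: contraTneq px => ->; rewrite /root p0 oppr_eq0 gt_eqF.
Qed.

Lemma cauchy_lower_mono (x y : R) :
  0 <= x -> x < y ->
  x ^+ h + \sum_(1 <= j < h) b j * x ^+ j < y ^+ h + \sum_(1 <= j < h) b j * y ^+ j.
Proof.
move=> x_ge0 lt_xy; apply: ltr_leD.
  by rewrite ltrXn2r // -lt0n.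
have y_ge0 : 0 <= y by rewrite ltW // (le_lt_trans x_ge0).
by apply: ler_sum => j _; rewrite ler_wpM2l // lerXn2r ?nnegrE // ltW.
Qed.

End PositiveRoots.

(** * Pellet and Cauchy bounds *)

(** The positive integers supply enough distinct nonzero points; the reversal below can only be
    evaluated away from 0. *)
Lemma poly_eq_horner_neq0 (K : numDomainType) (p q : {poly K}) :
  (forall z, z != 0 -> p.[z] = q.[z]) -> p = q.
Proof.
move=> eq_pq; apply/eqP; rewrite -subr_eq0; apply/eqP.
pose rs : seq K := [seq i.+1%:R | i <- iota 0 (size (p - q))].
apply: (@roots_geq_poly_eq0 _ _ rs); last by rewrite size_map size_iota.
  apply/allP => _ /mapP[i _ ->]; rewrite /root hornerD hornerN eq_pq ?subrr //.
  by rewrite pnatr_eq0.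
rewrite map_inj_in_uniq ?iota_uniq // => i j _ _ /eqP.
by rewrite eqr_nat => /eqP[].
Qed.

Lemma horner_det_sum (K : comNzRingType) (d h : nat) (C : nat -> 'M[K]_d) (z : K) :
  (\det (\sum_(j < h) 'X^j *: map_mx polyC (C j))).[z] =
  \det (\sum_(j < h) z ^+ j *: C j).
Proof.
rewrite -[LHS]/(horner_eval z _) -det_map_mx map_mx_sum; congr (\det _).
apply: eq_bigr => j _; apply/matrixP => r s.
by rewrite !mxE /= /horner_eval hornerM hornerXn hornerC.
Qed.

(** At [z != 0] the reversed polynomial is [z ^+ h] times the original at [z^-1]; the resulting
    power of [z] in the determinant gives each root one factor, [z (z^-1 - a) = 1 - a z]. A zero
    root becomes the factor 1. *)
Lemma det_reversal (K : numFieldType) (d h : nat) (C : nat -> 'M[K]_d) (s : seq K) :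
  size s = (d * h)%N ->
  \det (\sum_(j < h.+1) 'X^j *: map_mx polyC (C j)) = \prod_(a <- s) ('X - a%:P) ->
  \det (\sum_(j < h.+1) 'X^j *: map_mx polyC (C (h - j)%N)) =
  \prod_(a <- s) (1 - a *: 'X).
Proof.
move=> sz_s det_s; apply: poly_eq_horner_neq0 => z nz_z.
rewrite (horner_det_sum _ (fun j => C (h - j)%N)).
have -> : \sum_(j < h.+1) z ^+ j *: C (h - j)%N =
    z ^+ h *: \sum_(j < h.+1) z^-1 ^+ j *: C j.
  rewrite (reindex_inj rev_ord_inj) scaler_sumr; apply: eq_bigr => j _ /=.
  have le_jh : (j <= h)%N by rewrite -ltnS.
  by rewrite subSS subKn // scalerA exprVn expfB_cond // (negbTE nz_z).
rewrite detZ -horner_det_sum det_s -exprM mulnC -sz_s !horner_prod.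
elim: s {sz_s det_s} => [|a s IH]; first by rewrite !big_nil mulr1.
rewrite !big_cons /= exprS mulrACA IH; congr (_ * _).
by rewrite !hornerE mulrBr mulfV // mulrC.
Qed.

Lemma dvdp_prod_inv (K : fieldType) (s : seq K) (P : pred K) :
  (forall a, P a -> a != 0) ->
  \prod_(a <- [seq a^-1 | a <- s & P a]) ('X - a%:P) %|
  \prod_(a <- s) (1 - a *: 'X).
Proof.
move=> nzP; rewrite big_map big_filter.
elim: s => [|a s IH]; first by rewrite !big_nil dvdpp.
rewrite !big_cons; case: ifP => [/nzP nz_a|_]; last by rewrite dvdp_mull.
rewrite dvdp_mul // -(dvdpZr _ _ (c := - a^-1)) ?oppr_eq0 ?invr_eq0 //.
have -> : - a^-1 *: (1 - a *: 'X) = 'X - (a^-1)%:P.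
  by rewrite scalerBr scalerA mulNr mulVf // scaleN1r opprK addrC scaleNr alg_polyC.
by rewrite dvdpp.
Qed.

Section Pellet.

Variables (R : realType) (d : nat).
Variables (N : 'cV[R[i]]_d -> R) (nu : 'M[R[i]]_d -> R).
Hypotheses (normN : vector_norm N) (nuP : induced_norm N nu).
Variables (h : nat) (B : nat -> 'M[R[i]]_d).
Hypothesis h_gt0 : (0 < h)%N.

(** Appending the leading coefficient makes the monic polynomial a plain sum of [h.+1] terms. *)
Let C j : 'M[R[i]]_d := if (j < h)%N then B j else 1%:M.
Let eigs := mxpoly_eigenvalues (monic_mxpoly h B).

Lemma monic_mxpoly_sum :
  monic_mxpoly h B = \sum_(j < h.+1) 'X^j *: map_mx polyC (C j).
Proof.
rewrite big_ord_recr /= /C ltnn map_mx1 scale_scalar_mx mulr1 addrC.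
by congr (_ + _); apply: eq_bigr => j _; rewrite ltn_ord.
Qed.

Lemma eigenvector_monic_mxpoly (z : R[i]) :
  z \in eigs ->
  exists2 v : 'cV_d, v != 0 & \sum_(j < h.+1) z ^+ j *: (C j *m v) = 0.
Proof.
rewrite -root_prod_XsubC -det_monic_mxpoly_eigenvalues // monic_mxpoly_sum.
rewrite /root horner_det_sum -det_tr => /det0P[w nz_w wM]; exists w^T.
  by rewrite trmx_eq0.
move/(congr1 trmx): wM; rewrite trmx_mul trmxK trmx0 mulmx_suml => sum0.
by rewrite -[RHS]sum0; apply: eq_bigr => j _; rewrite scalemxAl.
Qed.

Lemma eigenvalue_monic_le (k : nat) (z : R[i]) :
  (k <= h)%N -> C k \in unitmx -> z \in eigs ->
  (nu (invmx (C k)))^-1 * Normc.normc z ^+ k <=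
    \sum_(j < h.+1 | j != k :> nat) nu (C j) * Normc.normc z ^+ j.
Proof.
move=> le_kh uCk /eigenvector_monic_mxpoly[v nz_v Qzv].
exact: (eigenvalue_le normN nuP le_kh uCk nz_v Qzv).
Qed.

Lemma sum_lt_top (x : R) :
  \sum_(j < h.+1 | j != h :> nat) nu (C j) * x ^+ j =
  \sum_(0 <= j < h) nu (B j) * x ^+ j.
Proof.
rewrite big_mkord big_mkcond big_ord_recr /= eqxx addr0.
by apply: eq_bigr => j _; rewrite ltn_eqF // /C ltn_ord.
Qed.

(** The dominance estimate for [k = h], where the coefficient is the identity, of norm 1. *)
Lemma eigenvalue_upper (z : R[i]) :
  z \in eigs ->
  Normc.normc z ^+ h <= \sum_(0 <= j < h) nu (B j) * Normc.normc z ^+ j.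
Proof.
move=> /(eigenvalue_monic_le (leqnn h)); rewrite sum_lt_top /C ltnn unitmx1 invmx1.
by rewrite (nu1 nuP) invr1 mul1r; apply.
Qed.

Lemma eigenvalue_lower (z : R[i]) :
  B 0%N \in unitmx -> z \in eigs ->
  (nu (invmx (B 0%N)))^-1 <=
    Normc.normc z ^+ h + \sum_(1 <= j < h) nu (B j) * Normc.normc z ^+ j.
Proof.
have C0 : C 0 = B 0%N by rewrite /C h_gt0.
move=> uB0 /(eigenvalue_monic_le (leq0n h)); rewrite C0 mulr1 => /(_ uB0).
move=> /le_trans -> //.
rewrite -(big_mkord (fun j => j != 0%N) (fun j => nu (C j) * Normc.normc z ^+ j)).
rewrite big_mkcond big_ltn //= add0r big_nat_recr //= -lt0n h_gt0.
rewrite {2}/C ltnn (nu1 nuP) mul1r addrC lerD2l.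
apply: ler_sum_nat => j /= /andP[j_gt0 lt_jh].
by rewrite -lt0n j_gt0 /C lt_jh.
Qed.

Section Gap.

Variables (k : nat) (y1 y2 : R).
Hypotheses (lt_kh : (k < h)%N) (Bk_unit : B k \in unitmx).
Hypotheses (y1_gt0 : 0 < y1) (lt_y12 : y1 < y2).
Hypotheses (root_y1 : root (pellet_poly nu h B k) y1)
           (root_y2 : root (pellet_poly nu h B k) y2).

Let CkE : C k = B k. Proof. by rewrite /C lt_kh. Qed.

Lemma horner_pellet_poly (y : R) :
  (pellet_poly nu h B k).[y] =
  \sum_(j < h.+1 | j != k :> nat) nu (C j) * y ^+ j -
  (nu (invmx (B k)))^-1 * y ^+ k.
Proof.
rewrite /pellet_poly !hornerE !(horner_sum_monomials (fun j => nu (B j))).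
have -> : \sum_(j < h.+1 | j != k :> nat) nu (C j) * y ^+ j =
    \sum_(0 <= j < k) nu (B j) * y ^+ j +
    \sum_(k.+1 <= j < h) nu (B j) * y ^+ j + y ^+ h.
  rewrite big_mkcond big_ord_recr /= gtn_eqF // /C ltnn (nu1 nuP) mul1r.
  congr (_ + _); rewrite -big_mkcond /=.
  rewrite -(big_mkord (fun j => j != k)
    (fun j => nu (if (j < h)%N then B j else 1%:M) * y ^+ j)).
  rewrite big_mkcond (big_cat_nat (n := k)) ?(ltnW lt_kh) //=; congr (_ + _).
    apply: eq_big_nat => j /= lt_jk.
    by rewrite ltn_eqF // (ltn_trans lt_jk).
  rewrite big_ltn // eqxx add0r; apply: eq_big_nat => j /= /andP[lt_kj ->].
  by rewrite gtn_eqF.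
ring.
Qed.

Lemma pellet_dominant (y : R) :
  y1 < y < y2 ->
  \sum_(j < h.+1 | j != k :> nat) nu (C j) * y ^+ j <
  (nu (invmx (C k)))^-1 * y ^+ k.
Proof.
case/andP=> lt1 lt2; rewrite CkE.
have root_eq x : root (pellet_poly nu h B k) x ->
    \sum_(j < h.+1 | j != k :> nat) nu (C j) * x ^+ j =
    (nu (invmx (B k)))^-1 * x ^+ k.
  by rewrite /root horner_pellet_poly subr_eq0 => /eqP.
have b_ge0 j : 0 <= nu (C j) by exact: nu_ge0 normN nuP _.
have bh_gt0 : 0 < nu (C h) by rewrite /C ltnn (nu1 nuP) ltr01.
have ne_hk : h != k by rewrite gtn_eqF.
exact: (pellet_neg (b := fun j => nu (C j)) b_ge0 bh_gt0 ne_hk y1_gt0 lt1 lt2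
  (root_eq _ root_y1) (root_eq _ root_y2)).
Qed.

Lemma pellet_gap (z : R[i]) : z \in eigs -> ~ (y1 < Normc.normc z < y2).
Proof.
move=> z_eig /pellet_dominant; rewrite ltNge => /negP; apply.
by apply: eigenvalue_monic_le => //; rewrite ?CkE // ltnW.
Qed.

(* At most [k d] eigenvalues lie inside and, applying the same bound to the
   reversed polynomial, at most [(h - k) d] lie outside; there are [h d]. *)
Lemma pellet_count : count (fun z => Normc.normc z <= y1) eigs = (k * d)%N.
Proof.
pose y := (y1 + y2) / 2%:R.
have y_in : y1 < y < y2 by rewrite !midf_lt.
have [lt1 lt2] := andP y_in; have y_gt0 := lt_trans y1_gt0 lt1.
have dom := pellet_dominant y_in.
have uCk : C k \in unitmx by rewrite CkE.
have det_eigs := det_monic_mxpoly_eigenvalues B h_gt0.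
have sz_eigs := size_mxpoly_eigenvalues B h_gt0.
rewrite -/eigs in det_eigs sz_eigs; rewrite monic_mxpoly_sum in det_eigs.
pose inner z := Normc.normc z <= y1 :> R.
have le_in : (count inner eigs <= k * d)%N.
  rewrite -size_filter.
  apply: (size_dominated_roots normN nuP (ltnW lt_kh) uCk y_gt0 dom).
    apply/allP => z; rewrite mem_filter => /andP[z_in _].
    exact: le_lt_trans z_in lt1.
  rewrite det_eigs -(perm_big _ (permEl (perm_filterC inner eigs))) big_cat /=.
  by rewrite dvdp_mulr.
have le_out : (count (predC inner) eigs <= (h - k) * d)%N.
  rewrite -size_filter -(size_map (fun z => z^-1)).
  have uC' : C (h - (h - k))%N \in unitmx by rewrite subKn // ltnW.
  have yi_gt0 : 0 < y^-1 by rewrite invr_gt0.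
  apply: (size_dominated_roots normN nuP (C := fun j => C (h - j)%N)
    (leq_subr k h) uC' yi_gt0).
  (* Dominance for the reversed polynomial at [y^-1] is the original inequality divided by
     [y ^+ h]. *)
  - rewrite (reindex_inj rev_ord_inj) /= subKn ?(ltnW lt_kh) //.
    rewrite -(ltr_pM2l (exprn_gt0 h y_gt0)) mulr_sumr mulrCA.
    have powE j : (j <= h)%N -> y ^+ h * y^-1 ^+ (h - j) = y ^+ j.
      move=> le_jh; rewrite exprVn -{1}(subnKC le_jh) exprD mulfK //.
      by rewrite expf_neq0 // gt_eqF.
    rewrite powE ?(ltnW lt_kh) //; apply: le_lt_trans dom.
    rewrite le_eqVlt; apply/orP; left; apply/eqP.
    apply: eq_big => [j|j _]; rewrite subSS.
      by rewrite eqn_sub2lE // ?(ltnW lt_kh) // -ltnS.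
    have le_jh : (j <= h)%N by rewrite -ltnS.
    by rewrite subKn // mulrCA powE.
  (* Outer eigenvalues avoid the gap, so their moduli are at least [y2 > y]. *)
  - apply/allP => x /mapP[z]; rewrite mem_filter => /andP[/= z_out z_eig] ->.
    rewrite Normc.normcV ltf_pV2 ?posrE //; last first.
      by rewrite (lt_trans y1_gt0) // ltNge.
    rewrite (lt_le_trans lt2) // leNgt; apply/negP => z_lt.
    by apply: (pellet_gap z_eig); rewrite z_lt ltNge z_out.
  - rewrite (det_reversal sz_eigs det_eigs).
    apply: dvdp_prod_inv => z /= z_out; apply: contraNneq z_out => ->.
    by rewrite /inner Normc.normc0 ltW.
apply/eqP; rewrite eqn_leq le_in /= -(leq_add2r ((h - k) * d)) -mulnDl.
rewrite subnKC ?(ltnW lt_kh) // mulnC -sz_eigs -(count_predC inner).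
by rewrite leq_add2l.
Qed.

End Gap.

End Pellet.

(** [perm_eq] carries multiplicities between [P] and [Q], and [|z| <= sqrt y] becomes [|z^2| <= y].
    The upper bound asks for a nonzero [B j], since otherwise the comparison polynomial is ['X^h],
    without positive root. *)
Theorem theorem4p1 (R : realType) (n m : nat) (A : nat -> 'M[R[i]]_m)
    (n_gt0 : (0 < n)%N) (n_even : ~~ odd n) (m_gt0 : (0 < m)%N) :
  let h := n./2 in
  let B : nat -> 'M[R[i]]_(m + m) := sq_coef n A in
  let eigP : seq R[i] := mxpoly_eigenvalues (monic_mxpoly n A) in
  let eigQ : seq R[i] := mxpoly_eigenvalues (monic_mxpoly h B) in
  perm_eq [seq z ^+ 2 | z <- eigP] eigQ
  /\
  forall (N : 'cV[R[i]]_(m + m) -> R) (nu : 'M[R[i]]_(m + m) -> R),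
    vector_norm N -> induced_norm N nu ->
    [/\ forall (k : nat) (y1 y2 : R),
          (1 <= k <= h.-1)%N -> B k \in unitmx ->
          0 < y1 -> y1 < y2 ->
          root (pellet_poly nu h B k) y1 -> root (pellet_poly nu h B k) y2 ->
          count (fun z => Normc.normc z <= Num.sqrt y1) eigP = (2 * k * m)%N
          /\ (forall z, z \in eigP ->
                ~ (Num.sqrt y1 < Normc.normc z < Num.sqrt y2)),
        (exists2 j, (j < h)%N & B j != 0) ->
          exists2 rho, unique_positive_root (cauchy_upper_poly nu h B) rho &
            forall z, z \in eigP -> Normc.normc z <= Num.sqrt rho
      & B 0%N \in unitmx ->
          exists2 tau, unique_positive_root (cauchy_lower_poly nu h B) tau &
            forall z, z \in eigP -> Num.sqrt tau <= Normc.normc z].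
Proof.
move=> h B eigP eigQ.
have sqr_eig : perm_eq [seq z ^+ 2 | z <- eigP] eigQ.
  exact: perm_sqr_eigenvalues.
split=> // N nu normN nuP.
have h_gt0 : (0 < h)%N by rewrite half_gt0; case: (n) n_gt0 n_even => [|[]].
have nu_ge0 := nu_ge0 normN nuP.
have in_eigQ z : z \in eigP -> z ^+ 2 \in eigQ.
  by rewrite -(perm_mem sqr_eig); exact: (map_f (fun z : R[i] => z ^+ 2)).
have normc_sqr (z : R[i]) : Normc.normc (z ^+ 2) = Normc.normc z ^+ 2.
  by rewrite !expr2 Normc.normcM.
have le_sqrt (z : R[i]) y : 0 < y ->
    (Normc.normc z <= Num.sqrt y) = (Normc.normc (z ^+ 2) <= y).
  move=> y_gt0; rewrite normc_sqr -{2}(sqr_sqrtr (ltW y_gt0)).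
  by rewrite ler_pXn2r ?nnegrE ?normc_ge0 ?sqrtr_ge0.
have sqrt_le (z : R[i]) y : 0 < y ->
    (Num.sqrt y <= Normc.normc z) = (y <= Normc.normc (z ^+ 2)).
  move=> y_gt0; rewrite normc_sqr -{2}(sqr_sqrtr (ltW y_gt0)).
  by rewrite ler_pXn2r ?nnegrE ?normc_ge0 ?sqrtr_ge0.
split.
- move=> k y1 y2 /andP[_ le_kh] uBk y1_gt0 lt_y12 root1 root2.
  have lt_kh : (k < h)%N by rewrite -(prednK h_gt0) ltnS.
  have y2_gt0 := lt_trans y1_gt0 lt_y12.
  split.
    have := pellet_count normN nuP h_gt0 lt_kh uBk y1_gt0 lt_y12 root1 root2.
    rewrite -/eigQ -(seq.permP sqr_eig) count_map addnn -mul2n mulnCA mulnA.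
    by move=> <-; apply: eq_count => z /=; rewrite le_sqrt.
  move=> z /in_eigQ z_eig; rewrite ltNge le_sqrt // ltNge sqrt_le // -!ltNge.
  exact: (pellet_gap normN nuP h_gt0 lt_kh uBk y1_gt0 root1 root2 z_eig).
- case=> l lt_lh nz_Bl.
  have [rho [rho_gt0 root_rho]] := cauchy_upper_root (fun j => nu_ge0 (B j)) h_gt0
    (ex_intro2 _ _ l lt_lh (nu_gt0 normN nuP nz_Bl)).
  have rootE x : root (cauchy_upper_poly nu h B) x ->
      x ^+ h = \sum_(0 <= j < h) nu (B j) * x ^+ j.
    rewrite /root hornerD hornerN hornerXn.
    by rewrite (horner_sum_monomials (fun j => nu (B j))) subr_eq0 => /eqP.
  have mono := @cauchy_mono _ (fun j => nu (B j))
    (fun j => nu_ge0 (B j)) h _ _ h_gt0.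
  exists rho.
    split=> // x [x_gt0 root_x].
    (* Equality at the smaller of two roots would be strict at the larger. *)
    case: (ltgtP rho x) => // [lt_rx|lt_xr].
      have := mono _ _ rho_gt0 lt_rx; rewrite -!rootE // ltxx lexx => H.
      by have := H isT.
    have := mono _ _ x_gt0 lt_xr; rewrite -!rootE // ltxx lexx => H.
    by have := H isT.
  move=> z /in_eigQ z_eig; rewrite le_sqrt // leNgt; apply/negP => lt_z.
  have := mono _ _ rho_gt0 lt_z; rewrite -rootE // lexx => /(_ isT).
  by rewrite ltNge (eigenvalue_upper normN nuP h_gt0 z_eig).
- move=> uB0; set c := (nu (invmx (B 0%N)))^-1.
  have c_gt0 : 0 < c by rewrite invr_gt0 (nu_invmx_gt0 normN nuP).
  have [tau [tau_gt0 root_tau]] :=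
    cauchy_lower_root (fun j => nu_ge0 (B j)) h_gt0 c_gt0.
  have rootE x : root (cauchy_lower_poly nu h B) x ->
      x ^+ h + \sum_(1 <= j < h) nu (B j) * x ^+ j = c.
    rewrite /root !hornerD hornerN hornerC hornerXn.
    by rewrite (horner_sum_monomials (fun j => nu (B j))) subr_eq0 => /eqP.
  have mono := @cauchy_lower_mono _ (fun j => nu (B j)) h
    (fun j => nu_ge0 (B j)) h_gt0.
  exists tau.
    split=> // x [x_gt0 root_x].
    case: (ltgtP tau x) => // lt_x.
      by have := mono _ _ (ltW tau_gt0) lt_x; rewrite !rootE // ltxx.
    by have := mono _ _ (ltW x_gt0) lt_x; rewrite !rootE // ltxx.
  move=> z /in_eigQ z_eig; rewrite sqrt_le // leNgt; apply/negP => lt_z.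
  have := mono _ _ (normc_ge0 _) lt_z; rewrite (rootE tau) // ltNge.
  by rewrite (eigenvalue_lower normN nuP h_gt0 uB0 z_eig).
Qed.
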